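(* Let $a\in\mathbb{R}\setminus\{0\}$, $M\in\mathbb{N}$ and $P\in\mathbb{N}$, where $\mathbb{N}=\{1,2,3,\ldots\}$. Define $f:\mathbb{R}\to\mathbb{R}$ by $f(t)=1-\frac{t^M}{a}$ and $F:\mathbb{R}\to\mathbb{R}$ by $$F(x)=\prod_{\ell=1}^{P}\left(1+\frac{1}{\ell M}\right)\int_{0}^{x} f(t)^{P}\,dt=\prod_{\ell=1}^{P}\left(1+\frac{1}{\ell M}\right)\int_{0}^{x}\left(1-\frac{t^{M}}{a}\right)^{P}dt .$$ Suppose $a>0$. Then the following hold. (a) $\sqrt[M]{a}$ is a fixed point of $F$, that is, $F(\sqrt[M]{a})=\sqrt[M]{a}$. (b) The derivatives of $F$ at $\sqrt[M]{a}$ up to order $P+1$ are given by $$F^{(k)}(\sqrt[M]{a})=0\quad\text{for } 1\le k\le P,\qquad F^{(P+1)}(\sqrt[M]{a})=\frac{(-1)^P}{\sqrt[M]{a^P}}\prod_{\ell=1}^{P}(1+\ell M).$$ (c) If the initial value $x_0$ is sufficiently close to $\sqrt[M]{a}$ (i.e. there is $\delta>0$ such that this holds for every real $x_0$ with $|x_0-\sqrt[M]{a}|<\delta$), then the sequence defined by $x_{n+1}=F(x_n)$, $n=0,1,\ldots$, converges to $\sqrt[M]{a}$, with order of convergence exactly $P+1$ (the order being understood for $x_0\neq\sqrt[M]{a}$).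
   Context: For $a>0$, $\sqrt[M]{a}$ denotes the positive real $M$-th root of $a$, and $\sqrt[M]{a^P}$ the positive real $M$-th root of $a^P$. $F^{(k)}$ denotes the $k$-th derivative of $F$. Order of convergence: a real sequence $(x_n)$ with limit $r$ and $x_n\neq r$ for all $n$ converges to $r$ with order of convergence exactly $q$ (where $q\ge 2$ is an integer) if the limit $\lim_{n\to\infty}\frac{x_{n+1}-r}{(x_n-r)^{q}}$ exists, is finite, and is nonzero. In particular, the order assertion includes that $x_n\neq r$ for all $n$. *)

(* Defs.v *)
From Stdlib Require Import Reals Lra Lia List.
From Coquelicot Require Import Coquelicot.
Open Scope R_scope.

(* For a > 0 this is the positive M-th root of a; see root_pos and root_pow. *)
Definition root (M : nat) (a : R) : R := Rpower a (/ INR M).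

Lemma root_pos (M : nat) (a : R) : 0 < root M a.
Proof. apply exp_pos. Qed.

Lemma root_pow (M : nat) (a : R) : (1 <= M)%nat -> 0 < a -> root M a ^ M = a.
Proof.
  intros HM Ha.
  rewrite <- Rpower_pow by apply root_pos.
  unfold root. rewrite Rpower_mult, Rinv_l.
  - now apply Rpower_1.
  - apply not_0_INR. lia.
Qed.

(* g 1 * ... * g n, equal to 1 when n = 0. *)
Definition prod_from_1 (n : nat) (g : nat -> R) : R :=
  fold_right Rmult 1 (map g (seq 1 n)).

Definition f (a : R) (M : nat) (t : R) : R := 1 - t ^ M / a.

(* RInt is oriented, so x may be negative; the integral exists by ex_RInt_f. *)
Definition F (a : R) (M P : nat) (x : R) : R :=
  prod_from_1 P (fun l => 1 + 1 / (INR l * INR M)) *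
  RInt (fun t => f a M t ^ P) 0 x.

Lemma ex_RInt_f (a : R) (M P : nat) (x y : R) :
  ex_RInt (fun t => f a M t ^ P) x y.
Proof.
  apply (ex_RInt_continuous (V := R_CompleteNormedModule)).
  intros z _. apply continuity_pt_filterlim.
  apply derivable_continuous_pt, ex_derive_Reals_0.
  unfold f, Rdiv. auto_derive. exact I.
Qed.

Definition converges_with_exact_order (x : nat -> R) (r : R) (q : nat) : Prop :=
  (2 <= q)%nat /\
  is_lim_seq x r /\
  (forall n, x n <> r) /\
  exists L : R, L <> 0 /\
    is_lim_seq (fun n => (x (S n) - r) / (x n - r) ^ q) L.

(* Main.v *)
From Stdlib Require Import Arith Reals Lra Lia List.
From Coquelicot Require Import Coquelicot.
(* Last, so that [f] is not the record projection of [Rtopology.family]. *)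
Require Import Defs.
Open Scope R_scope.

(** Write [r] for the root and [y = x - r]. Since [f] is a polynomial with a
    simple zero at [r], [F' = C f^P = y^P h(y)] with [h] a polynomial and
    [h(0) = C f'(r)^P <> 0]; this gives the derivatives at [r].
    The fixed point equation comes from
    [(t f^(P+1))' = (1 + (P+1) M) f^(P+1) - (P+1) M f^P], which telescopes the
    product in front of the integral. Integrating [F'] coefficientwise,
    [F(x) - r = y^(P+1) G(y)] with [G] a polynomial and [G(0) <> 0]: near [r] the
    error is at least halved at each step, never becomes zero, and its ratio
    to the [(P+1)]-st power of the previous error is [G(y_n)], which tends to
    [G(0)]. *)

(** * Polynomials as coefficient lists in Horner form *)

Fixpoint peval (l : list R) (y : R) : R :=
  match l with
  | nil => 0
  | c :: l' => c + y * peval l' y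
  end.

(** Existential, so that closure under sums, products and powers gives a coefficient list without
    computing one. *)
Definition is_poly (h : R -> R) : Prop := exists l, forall y, h y = peval l y.

Lemma is_poly_const (c : R) : is_poly (fun _ => c).
Proof. exists (c :: nil). intros y. simpl. ring. Qed.

Lemma is_poly_id : is_poly (fun y => y).
Proof. exists (0 :: 1 :: nil). intros y. simpl. ring. Qed.

Lemma is_poly_plus (g h : R -> R) :
  is_poly g -> is_poly h -> is_poly (fun y => g y + h y).
Proof.
  intros [l Hl] [m Hm].
  enough (E : exists k, forall y, peval l y + peval m y = peval k y).
  { destruct E as [k Hk]. exists k. intros y. now rewrite Hl, Hm. }
  clear g h Hl Hm. revert m. induction l as [|c l IH]; intros m.
  - exists m. intros y. simpl. ring.
  - destruct m as [|d m].
    + exists (c :: l). intros y. simpl. ring.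
    + destruct (IH m) as [k Hk]. exists (c + d :: k). intros y. simpl.
      rewrite <- Hk. ring.
Qed.

Lemma is_poly_scal (c : R) (h : R -> R) : is_poly h -> is_poly (fun y => c * h y).
Proof.
  intros [l Hl]. exists (map (Rmult c) l). intros y. rewrite Hl. clear Hl.
  induction l as [|d l IH]; simpl; [ring | rewrite <- IH; ring].
Qed.

Lemma is_poly_mult (g h : R -> R) :
  is_poly g -> is_poly h -> is_poly (fun y => g y * h y).
Proof.
  intros [l Hl] Hh.
  enough (E : is_poly (fun y => peval l y * h y)).
  { destruct E as [k Hk]. exists k. intros y. now rewrite Hl. }
  clear g Hl. induction l as [|c l [k Hk]].
  - exists nil. intros y. simpl. ring.
  - destruct (is_poly_plus _ (peval (0 :: k)) (is_poly_scal c h Hh)) as [m Hm].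
    { now exists (0 :: k). }
    exists m. intros y. rewrite <- Hm. simpl. rewrite <- Hk. ring.
Qed.

Lemma is_poly_pow (h : R -> R) (n : nat) : is_poly h -> is_poly (fun y => h y ^ n).
Proof.
  intros Hh. induction n as [|n IH]; simpl.
  - apply is_poly_const.
  - now apply is_poly_mult.
Qed.

(** In Horner form the value at 0 is the head coefficient; once it vanishes, the tail is the
    cofactor. *)
Lemma is_poly_factor (h : R -> R) :
  is_poly h -> h 0 = 0 -> exists l, forall y, h y = y * peval l y.
Proof.
  intros [[|c l] Hl] H0.
  - exists nil. intros y. rewrite Hl. simpl. ring.
  - exists l. intros y. rewrite Hl in H0. simpl in H0. rewrite Hl. simpl.
    replace c with 0 by lra. ring.
Qed.

Lemma ex_derive_peval (l : list R) (y : R) : ex_derive (peval l) y.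
Proof.
  induction l as [|c l IH]; simpl.
  - apply ex_derive_const.
  - apply (ex_derive_plus (fun _ => c) (fun y => y * peval l y)).
    + apply ex_derive_const.
    + apply ex_derive_mult; [apply ex_derive_id | exact IH].
Qed.

Lemma continuous_peval (l : list R) (y : R) : continuous (peval l) y.
Proof. apply (ex_derive_continuous (peval l)), ex_derive_peval. Qed.

(* [y^n * peval (pderiv n l) y] is the derivative of [y^(n+1) * peval l y],
   and [pint n] inverts [pderiv n]. *)
Fixpoint pderiv (n : nat) (l : list R) : list R :=
  match l with
  | nil => nil
  | c :: l' => INR (S n) * c :: pderiv (S n) l'
  end.

Fixpoint pint (n : nat) (l : list R) : list R :=
  match l with
  | nil => nil
  | c :: l' => c / INR (S n) :: pint (S n) l'
  end.

Lemma pderiv_pint (n : nat) (l : list R) : pderiv n (pint n l) = l.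
Proof.
  revert n. induction l as [|c l IH]; intros n; [reflexivity|].
  cbn [pint pderiv]. rewrite IH. f_equal. field. apply not_0_INR. lia.
Qed.

Lemma peval_pderiv_0 (n : nat) (l : list R) :
  peval (pderiv n l) 0 = INR (S n) * peval l 0.
Proof. destruct l as [|c l]; cbn [pderiv peval]; ring. Qed.

Lemma peval_pint_0 (n : nat) (l : list R) :
  peval (pint n l) 0 = peval l 0 / INR (S n).
Proof.
  rewrite <- (pderiv_pint n l) at 2. rewrite peval_pderiv_0.
  field. apply not_0_INR. lia.
Qed.

(** * Derivatives of a power of [x - r] times a polynomial *)

Lemma is_derive_shift_pow_peval (r : R) (n : nat) (l : list R) (x : R) :
  is_derive (fun x => (x - r) ^ S n * peval l (x - r)) x
    ((x - r) ^ n * peval (pderiv n l) (x - r)).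
Proof.
  revert n. induction l as [|c l IH]; intros n.
  - simpl. rewrite Rmult_0_r.
    apply is_derive_ext with (fun _ => 0); [intros t; now rewrite Rmult_0_r|].
    apply (is_derive_const (V := R_NormedModule)).
  (* The constant coefficient splits off and the tail carries one more power of [x - r], hence the
     induction over all [n]. *)
  - apply is_derive_ext with
      (fun x => c * (x - r) ^ S n + (x - r) ^ S (S n) * peval l (x - r)).
    { intros t. cbn [pow peval].
      match goal with |- @eq _ ?u ?v => change (@eq R u v) end. ring. }
    replace ((x - r) ^ n * peval (pderiv n (c :: l)) (x - r))
      with (c * (INR (S n) * (x - r) ^ n) +
            (x - r) ^ S n * peval (pderiv (S n) l) (x - r))
      by (cbn [pderiv peval pow]; ring).
    apply (is_derive_plus (V := R_NormedModule)); [|apply IH].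
    auto_derive; [exact I|].
    change (c * (1 * (INR (S n) * (x - r) ^ n)) = c * (INR (S n) * (x - r) ^ n)).
    ring.
Qed.

(** Iterated derivatives add the new derivative last; this peels off the first one instead, so that
    a known formula for [g'] can be used. *)
Lemma is_derive_n_S (g g' : R -> R) (k : nat) (x l : R) :
  (forall t, is_derive g t (g' t)) ->
  is_derive_n g' k x l -> is_derive_n g (S k) x l.
Proof.
  intros Hg.
  assert (E : forall j t, Derive_n g (S j) t = Derive_n g' j t).
  { induction j as [|j IH]; intros t.
    - apply is_derive_unique, Hg.
    - apply Derive_ext. exact IH. }
  destruct k as [|k]; intros Hk.
  - simpl in Hk. rewrite <- Hk. apply Hg.
  - apply is_derive_ext with (Derive_n g' k); [|exact Hk].
    intros t. symmetry. apply E.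
Qed.

(** Each derivative lowers the exponent by one and multiplies the cofactor's value at 0 by the old
    exponent. A positive power of [x - r] survives until [k = n], when the exponents have
    accumulated to [n!]. *)
Lemma is_derive_n_shift_pow_peval (r : R) (n k : nat) (l : list R) :
  (k <= n)%nat ->
  is_derive_n (fun x => (x - r) ^ n * peval l (x - r)) k r
    (if Nat.eqb k n then INR (fact n) * peval l 0 else 0).
Proof.
  revert n l. induction k as [|k IH]; intros n l Hk.
  - destruct n as [|n]; simpl; rewrite Rminus_eq_0; ring.
  - destruct n as [|n]; [lia|].
    apply is_derive_n_S with (fun x => (x - r) ^ n * peval (pderiv n l) (x - r)).
    { intros t. apply is_derive_shift_pow_peval. }
    replace (INR (fact (S n)) * peval l 0)
      with (INR (fact n) * peval (pderiv n l) 0)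
      by (rewrite peval_pderiv_0, fact_simpl, mult_INR; ring).
    apply IH. lia.
Qed.

Lemma is_derive_0_eq (g : R -> R) (x y : R) :
  (forall t, is_derive g t 0) -> g x = g y.
Proof.
  intros Hg. destruct (Rtotal_order x y) as [H|[->|H]].
  - apply (eq_is_derive (V := R_NormedModule)); [intros; apply Hg | exact H].
  - reflexivity.
  - symmetry.
    apply (eq_is_derive (V := R_NormedModule)); [intros; apply Hg | exact H].
Qed.

(** * Roots of powers and the normalizing product *)

Lemma root_pow_base (M P : nat) (a : R) : 0 < a -> root M (a ^ P) = root M a ^ P.
Proof.
  intros Ha. rewrite <- (Rpower_pow P (root M a)) by apply root_pos.
  unfold root. rewrite <- Rpower_pow by exact Ha.
  rewrite !Rpower_mult. f_equal. ring.
Qed.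

Lemma prod_from_1_S (n : nat) (g : nat -> R) :
  prod_from_1 (S n) g = prod_from_1 n g * g (S n).
Proof.
  unfold prod_from_1. rewrite seq_S, map_app, fold_right_app. simpl.
  rewrite Rmult_1_r. generalize (map g (seq 1 n)) (g (S n)). intros l c.
  induction l as [|d l IH]; simpl; [ring | rewrite IH; ring].
Qed.

(** Factor by factor, [(1 + 1/(l M)) * (l M) = 1 + l M]. *)
Lemma prod_from_1_inv_mult (M P : nat) : (1 <= M)%nat ->
  prod_from_1 P (fun l => 1 + 1 / (INR l * INR M)) * (INR (fact P) * INR M ^ P) =
  prod_from_1 P (fun l => 1 + INR l * INR M).
Proof.
  intros HM. induction P as [|P IH].
  - unfold prod_from_1. simpl. ring.
  - rewrite !prod_from_1_S, <- IH, fact_simpl, mult_INR. simpl (_ ^ S P).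
    field. split; apply not_0_INR; lia.
Qed.

Lemma prod_from_1_pos (P : nat) (g : nat -> R) :
  (forall l, (1 <= l)%nat -> 0 < g l) -> 0 < prod_from_1 P g.
Proof.
  intros Hg. induction P as [|P IH].
  - unfold prod_from_1. simpl. lra.
  - rewrite prod_from_1_S. apply Rmult_lt_0_compat; [exact IH | apply Hg; lia].
Qed.

Lemma factor_pos (M l : nat) :
  (1 <= M)%nat -> (1 <= l)%nat -> 0 < 1 + 1 / (INR l * INR M).
Proof.
  intros HM Hl.
  assert (0 < 1 / (INR l * INR M)); [|lra].
  apply Rdiv_lt_0_compat; [lra|]. apply Rmult_lt_0_compat; apply lt_0_INR; lia.
Qed.

(** * The derivative of [F] and the fixed point *)

Lemma is_derive_RInt_f (a : R) (M P : nat) (x : R) :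
  is_derive (fun x => RInt (fun t => f a M t ^ P) 0 x) x (f a M x ^ P).
Proof.
  apply (is_derive_RInt (V := R_NormedModule) (fun t => f a M t ^ P)) with 0.
  - apply filter_forall. intros t.
    apply (RInt_correct (V := R_CompleteNormedModule)), ex_RInt_f.
  - apply (ex_derive_continuous (fun t => f a M t ^ P)).
    unfold f, Rdiv. auto_derive. exact I.
Qed.

Lemma is_derive_F (a : R) (M P : nat) (x : R) :
  is_derive (F a M P) x
    (prod_from_1 P (fun l => 1 + 1 / (INR l * INR M)) * f a M x ^ P).
Proof. apply is_derive_scal, is_derive_RInt_f. Qed.

(** Both sides vanish at 0 and have the same derivative, because [t f'(t) = M (f(t) - 1)]. *)
Lemma RInt_f_recurrence (a : R) (M P : nat) (x : R) : (1 <= M)%nat ->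
  (1 + INR (S P) * INR M) * RInt (fun t => f a M t ^ S P) 0 x -
  INR (S P) * INR M * RInt (fun t => f a M t ^ P) 0 x = x * f a M x ^ S P.
Proof.
  intros HM.
  pose (A := fun x => RInt (fun t => f a M t ^ S P) 0 x).
  pose (B := fun x => RInt (fun t => f a M t ^ P) 0 x).
  pose (D := fun x => (1 + INR (S P) * INR M) * A x - INR (S P) * INR M * B x
                      - x * f a M x ^ S P).
  enough (HD : D x = D 0).
  { unfold D, A, B in HD. rewrite !RInt_point in HD.
    change (@zero R_CompleteNormedModule) with 0 in HD. lra. }
  apply is_derive_0_eq. intros t.
  replace 0 with ((1 + INR (S P) * INR M) * f a M t ^ S P
    - INR (S P) * INR M * f a M t ^ P
    - ((1 + INR (S P) * INR M) * f a M t ^ S P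
       - INR (S P) * INR M * f a M t ^ P)) by ring.
  apply (is_derive_minus (V := R_NormedModule)).
  - apply (is_derive_minus (V := R_NormedModule)); apply is_derive_scal;
      apply is_derive_RInt_f.
  - destruct M as [|M]; [lia|]. unfold f, Rdiv. auto_derive; [exact I|].
    change (1 + - (t * t ^ M * / a)) with (1 - t * t ^ M * / a).
    change (match M with O => 1 | S _ => INR M + 1 end) with (INR (S M)).
    change (match P with O => 1 | S _ => INR P + 1 end) with (INR (S P)).
    cbn [pow]. ring.
Qed.

Lemma f_root (a : R) (M : nat) : (1 <= M)%nat -> 0 < a -> f a M (root M a) = 0.
Proof.
  intros HM Ha. unfold f. rewrite root_pow by assumption. field. lra.
Qed.

(** Induction on [P], starting from the identity map at [P = 0]. At the root the boundary term
    [x * f^(P+1)] of the recurrence vanishes, so the new factor of the product exactly offsets the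
    change of the integral. *)
Lemma F_root (a : R) (M P : nat) : (1 <= M)%nat -> 0 < a ->
  F a M P (root M a) = root M a.
Proof.
  intros HM Ha. unfold F. induction P as [|P IH].
  - unfold prod_from_1. simpl. rewrite RInt_const.
    unfold scal; simpl; unfold mult; simpl. ring.
  - rewrite <- IH at 2. rewrite prod_from_1_S, Rmult_assoc. f_equal.
    assert (H := RInt_f_recurrence a M P (root M a) HM).
    rewrite f_root, pow_i, Rmult_0_r in H by (assumption || lia).
    assert (0 < INR M) by (apply lt_0_INR; lia).
    assert (0 < INR (S P)) by (apply lt_0_INR; lia).
    apply Rmult_eq_reg_l with (INR (S P) * INR M);
      [|apply Rgt_not_eq, Rmult_lt_0_compat; assumption].
    rewrite <- Rmult_assoc.
    replace (INR (S P) * INR M * (1 + 1 / (INR (S P) * INR M)))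
      with (1 + INR (S P) * INR M) by (field; split; lra).
    lra.
Qed.

(** * Factoring [F'] and [F - r] at the root *)

Lemma f_factor_root (a : R) (M : nat) : (1 <= M)%nat -> 0 < a ->
  exists l, peval l 0 = - INR M / root M a /\
    forall x, f a M x = (x - root M a) * peval l (x - root M a).
Proof.
  intros HM Ha. set (r := root M a).
  assert (Hr : 0 < r) by apply root_pos.
  destruct (is_poly_factor (fun y => 1 + - / a * (r + y) ^ M)) as [l Hl].
  - apply is_poly_plus; [apply is_poly_const|].
    apply is_poly_scal, is_poly_pow, is_poly_plus;
      [apply is_poly_const | apply is_poly_id].
  - rewrite Rplus_0_r. unfold r. rewrite root_pow by assumption. field. lra.
  - exists l.
    assert (Hf : forall x, f a M x = (x - r) * peval l (x - r)).
    { intros x. rewrite <- Hl. unfold f, Rdiv.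
      replace (r + (x - r)) with x by ring. ring. }
    split; [|exact Hf].
    (* The cofactor's value at 0 is [f'(r)]: it is computed once from the factored form and once
       directly, using [a = r^M]. *)
    assert (D1 := is_derive_n_shift_pow_peval r 1 1 l (le_n 1)).
    simpl in D1. apply is_derive_unique in D1.
    assert (D2 : is_derive (f a M) r (- INR M / r)).
    { unfold f, Rdiv. auto_derive; [exact I|].
      rewrite <- (root_pow M a) by assumption. fold r.
      destruct M as [|M']; [lia|]. simpl pred. cbn [pow]. field.
      split; [|apply pow_nonzero]; lra. }
    apply is_derive_unique in D2.
    rewrite <- D2, (Derive_ext _ (fun x => (x - r) * 1 * peval l (x - r))).
    + rewrite D1. ring.
    + intros t. rewrite Hf. ring.
Qed.

Lemma F_derivative_factor (a : R) (M P : nat) : (1 <= M)%nat -> 0 < a ->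
  exists l,
    peval l 0 = prod_from_1 P (fun l => 1 + 1 / (INR l * INR M)) *
                (- INR M / root M a) ^ P /\
    forall x, is_derive (F a M P) x ((x - root M a) ^ P * peval l (x - root M a)).
Proof.
  intros HM Ha.
  destruct (f_factor_root a M HM Ha) as [l [Hl0 Hl]].
  set (C := prod_from_1 P (fun l => 1 + 1 / (INR l * INR M))).
  destruct (is_poly_scal C _ (is_poly_pow (peval l) P (ex_intro _ l (fun y => eq_refl))))
    as [m Hm].
  exists m. split.
  - now rewrite <- Hm, Hl0.
  - intros x. rewrite <- Hm.
    replace ((x - root M a) ^ P * (C * peval l (x - root M a) ^ P))
      with (C * f a M x ^ P) by (rewrite Hl, Rpow_mult_distr; ring).
    apply is_derive_F.
Qed.

(** Both sides have the same derivative, and both vanish at [r] by the fixed point equation. *)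
Lemma F_expansion (a r : R) (M P : nat) (l : list R) :
  F a M P r = r ->
  (forall x, is_derive (F a M P) x ((x - r) ^ P * peval l (x - r))) ->
  forall x, F a M P x - r = (x - r) ^ S P * peval (pint P l) (x - r).
Proof.
  intros Hr HF x.
  pose (D := fun x => F a M P x - (x - r) ^ S P * peval (pint P l) (x - r)).
  assert (E : D x = D r).
  { apply is_derive_0_eq. intros t.
    replace 0 with ((t - r) ^ P * peval l (t - r)
                    - (t - r) ^ P * peval (pderiv P (pint P l)) (t - r))
      by (rewrite pderiv_pint; ring).
    apply (is_derive_minus (V := R_NormedModule));
      [apply HF | apply is_derive_shift_pow_peval]. }
  unfold D in E. rewrite Hr, Rminus_eq_0, pow_i in E by lia. lra.
Qed.

(** * Local convergence of the iteration and its order *)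

Lemma iteration_exact_order (G phi : R -> R) (r : R) (P : nat) :
  (1 <= P)%nat -> continuous G 0 -> G 0 <> 0 ->
  (forall x, phi x - r = (x - r) ^ S P * G (x - r)) ->
  exists delta : R, 0 < delta /\
    forall x : nat -> R,
      Rabs (x 0%nat - r) < delta ->
      (forall n : nat, x (S n) = phi (x n)) ->
      is_lim_seq x r /\
      (x 0%nat <> r -> converges_with_exact_order x r (S P)).
Proof.
  intros HP HG HG0 Hphi.
  (* [K] is the factor by which one step multiplies the error; [K 0 = 0] since [P >= 1]. *)
  pose (K := fun y => y ^ P * G y).
  assert (HK : continuous K 0).
  { apply (continuous_mult (fun y => y ^ P) G); [|exact HG].
    apply (ex_derive_continuous (fun y => y ^ P)). auto_derive. exact I. }
  assert (HK0 : K 0 = 0) by (unfold K; rewrite pow_i by lia; ring).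
  assert (Hloc : locally 0 (fun y => Rabs (K y) < / 2 /\ G y <> 0)).
  { apply filter_and.
    - apply (HK (fun z => Rabs z < / 2)). rewrite HK0. exists (mkposreal (/ 2) ltac:(lra)).
      intros z Hz. change (Rabs (z - 0) < / 2) in Hz.
      now rewrite Rminus_0_r in Hz.
    (* The ball of radius [|G 0|] around [G 0] misses 0. *)
    - apply (HG (fun z => z <> 0)). exists (mkposreal (Rabs (G 0)) (Rabs_pos_lt _ HG0)).
      intros z Hz ->. change (Rabs (0 - G 0) < Rabs (G 0)) in Hz.
      rewrite Rminus_0_l, Rabs_Ropp in Hz. lra. }
  destruct Hloc as [delta Hdelta].
  exists delta. split; [apply cond_pos|].
  intros x Hx0 Hx.
  assert (Hball : forall y, Rabs y < delta -> Rabs (K y) < / 2 /\ G y <> 0).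
  { intros y Hy. apply Hdelta. change (Rabs (y - 0) < delta).
    now rewrite Rminus_0_r. }
  assert (Hstep : forall n, x (S n) - r = (x n - r) * K (x n - r)).
  { intros n. rewrite Hx, Hphi. unfold K. simpl. ring. }
  (* The second conjunct keeps the iterates in the ball where the bound on [K] is available. *)
  assert (Hgeom : forall n, Rabs (x n - r) <= delta * (/ 2) ^ n /\
                            Rabs (x n - r) < delta).
  { induction n as [|n [IH1 IH2]].
    - simpl. lra.
    - rewrite Hstep, Rabs_mult.
      destruct (Hball _ IH2) as [HKn _].
      assert (Hn := Rabs_pos (x n - r)). assert (HKp := Rabs_pos (K (x n - r))).
      simpl pow. split; nra. }
  assert (Hlim : is_lim_seq (fun n => x n - r) 0).
  { apply is_lim_seq_abs_0.
    apply is_lim_seq_le_le with (fun _ => 0) (fun n => delta * (/ 2) ^ n).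
    - intros n. split; [apply Rabs_pos | apply Hgeom].
    - apply is_lim_seq_const.
    - replace (Finite 0) with (Rbar_mult delta 0)
        by (simpl; now rewrite Rmult_0_r).
      apply is_lim_seq_scal_l, is_lim_seq_geom. rewrite Rabs_pos_eq; lra. }
  assert (Hx_lim : is_lim_seq x r).
  { apply is_lim_seq_ext with (fun n => (x n - r) + r); [intros; ring|].
    replace (Finite r) with (Finite (0 + r)) by (f_equal; ring).
    apply is_lim_seq_plus'; [exact Hlim | apply is_lim_seq_const]. }
  split; [exact Hx_lim|].
  intros Hne.
  (* The next error is a product of nonzero factors, as [G] has no zero in the ball. *)
  assert (Hnz : forall n, x n - r <> 0).
  { induction n as [|n IH]; [lra|].
    rewrite Hstep. unfold K.
    repeat apply Rmult_integral_contrapositive_currified;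
      [exact IH | now apply pow_nonzero | apply Hball, Hgeom]. }
  split; [lia|]. split; [exact Hx_lim|]. split.
  { intros n E. apply (Hnz n). lra. }
  exists (G 0). split; [exact HG0|].
  apply is_lim_seq_ext with (fun n => G (x n - r)).
  - intros n. rewrite Hx, Hphi. field. now apply pow_nonzero.
  - apply (filterlim_comp _ _ _ (fun n => x n - r) G _ (locally 0));
      [exact Hlim | exact HG].
Qed.

(** * Fixed point, derivatives and order of convergence combined *)

Theorem mainTheorem1 (a : R) (M P : nat)
  (ha : a <> 0) (hM : (1 <= M)%nat) (hP : (1 <= P)%nat) (hpos : 0 < a) :
  F a M P (root M a) = root M a
  /\
  ((forall k : nat, (1 <= k <= P)%nat -> is_derive_n (F a M P) k (root M a) 0) /\
   is_derive_n (F a M P) (P + 1) (root M a)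
     ((-1) ^ P / root M (a ^ P) * prod_from_1 P (fun l => 1 + INR l * INR M)))
  /\
  (exists delta : R, 0 < delta /\
    forall x : nat -> R,
      Rabs (x 0%nat - root M a) < delta ->
      (forall n : nat, x (S n) = F a M P (x n)) ->
      is_lim_seq x (root M a) /\
      (x 0%nat <> root M a ->
       converges_with_exact_order x (root M a) (P + 1))).
Proof.
  assert (Hr := root_pos M a).
  assert (HMpos : 0 < INR M) by (apply lt_0_INR; lia).
  assert (Hfix := F_root a M P hM hpos).
  destruct (F_derivative_factor a M P hM hpos) as [l [Hl0 Hl]].
  replace (P + 1)%nat with (S P) by lia.
  split; [exact Hfix|]. split; [split|].
  (* From here [k] is the order minus one, so [k < P] derivatives of [F'] remain to be taken. *)
  - intros [|k] Hk; [lia|].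
    apply is_derive_n_S with (1 := Hl).
    assert (D := is_derive_n_shift_pow_peval (root M a) P k l ltac:(lia)).
    now rewrite (proj2 (Nat.eqb_neq k P)) in D by lia.
  - apply is_derive_n_S with (1 := Hl).
    assert (D := is_derive_n_shift_pow_peval (root M a) P P l (le_n P)).
    rewrite Nat.eqb_refl, Hl0 in D.
    (* The target product becomes [C * (P! * M^P)], with [P!] from differentiating [(x - r)^P] and
       [M^P] from [(-M/r)^P]. *)
    rewrite root_pow_base, <- prod_from_1_inv_mult by assumption.
    replace (- INR M / root M a) with (-1 * INR M * / root M a) in D by (field; lra).
    rewrite !Rpow_mult_distr, pow_inv in D.
    match type of D with is_derive_n _ _ _ ?v =>
      match goal with |- is_derive_n _ _ _ ?w => replace w with v; [exact D|] end
    end.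
    unfold Rdiv. ring.
  - apply (iteration_exact_order (peval (pint P l))).
    + exact hP.
    + apply continuous_peval.
    (* The limit constant is [C * (-M/r)^P / (P+1)], a product of nonzero factors. *)
    + rewrite peval_pint_0, Hl0.
      apply Rmult_integral_contrapositive_currified;
        [|apply Rinv_neq_0_compat, not_0_INR; lia].
      apply Rmult_integral_contrapositive_currified.
      * apply Rgt_not_eq, prod_from_1_pos. intros j Hj. now apply factor_pos.
      * apply pow_nonzero. apply Rmult_integral_contrapositive_currified;
          [lra | apply Rinv_neq_0_compat; lra].
    + now apply F_expansion.
Qed.
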